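(* Let $(\Sigma,\partial)$ be a differential field whose field of constants $\mathbf{C}$ is algebraically closed and of characteristic zero. Let $P,Q\in\Sigma[\partial]\setminus\mathbf{C}[\partial]$ be commuting differential operators, both of positive order, let $h=\partial\mathrm{Res}(P-\lambda,Q-\mu)$ and let $f=\sqrt{h}$ be the square-free part of $h$. Then $f$ is the irreducible polynomial such that $$\mathrm{BC}(P,Q)=(f),$$ where $(f)$ is the ideal generated by $f$ in $\mathbf{C}[\lambda,\mu]$.
   Context: $\Sigma[\partial]$ is the ring of differential operators with coefficients in $\Sigma$ ($\partial a=a\partial+\partial(a)$). $\lambda,\mu$ are algebraic variables over $\Sigma$ with $\partial(\lambda)=\partial(\mu)=0$. Burchnall–Chaundy ideal: $\mathrm{BC}(P,Q)=\{g\in\mathbf{C}[\lambda,\mu]\mid g(P,Q)=0\}$, the kernel of the ring homomorphism $\mathbf{C}[\lambda,\mu]\to\Sigma[\partial]$, $\lambda\mapsto P$, $\mu\mapsto Q$. Differential resultant: for operators $A,B$ of orders $n,m$ with coefficients in a differential domain $\mathbb{D}$, $\partial\mathrm{Res}(A,B)$ is the determinant of the $(n+m)\times(n+m)$ matrix whose rows are the coefficients, with respect to $\partial^{n+m-1},\dots,\partial,1$, of $\partial^{m-1}A,\dots,\partial A,A,\partial^{n-1}B,\dots,\partial B,B$. Here $\mathbb{D}=\Sigma[\lambda,\mu]$. *)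

(* Defs.v *)
From HB Require Import structures.
From mathcomp Require Import all_boot all_order all_algebra.

Set Implicit Arguments.
Unset Strict Implicit.
Unset Printing Implicit Defensive.

Import GRing.Theory.
Local Open Scope ring_scope.

HB.mixin Record hasDerivation R of GRing.ComNzRing R := {
  der : R -> R;
  derD : {morph der : a b / a + b};
  derM : forall a b, der (a * b) = der a * b + a * der b
}.

#[short(type="diffRingType")]
HB.structure Definition DiffRing := {R of GRing.ComNzRing R & hasDerivation R}.

#[short(type="diffFieldType")]
HB.structure Definition DiffField := {R of GRing.Field R & hasDerivation R}.

Section DerivationTheory.
Variable R : diffRingType.

Lemma der0 : der (0 : R) = 0.
Proof. by apply: (addrI (der 0)); rewrite -derD !addr0. Qed.

Lemma der1 : der (1 : R) = 0.
Proof.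
by apply: (addrI (der 1)); rewrite addr0 -{3}(mulr1 1) derM mulr1 mul1r.
Qed.

Lemma derN (a : R) : der (- a) = - der a.
Proof. by apply: (addrI (der a)); rewrite -derD !subrr der0. Qed.

HB.instance Definition _ :=
  GRing.isNmodMorphism.Build R R (@der R) (der0, derD).

End DerivationTheory.

(* R[x] with the derivation acting on the coefficients, so that x is a
   constant. Iterating it gives the derivation of R[x][y]. *)
Section PolyDerivation.
Variable R : diffRingType.

Definition poly_der : {poly R} -> {poly R} := map_poly der.

Lemma poly_derD : {morph poly_der : p q / p + q}.
Proof. exact: raddfD. Qed.

Lemma poly_derM p q : poly_der (p * q) = poly_der p * q + p * poly_der q.
Proof.
apply/polyP=> i; rewrite coef_map coefD !coefM raddf_sum -big_split /=.
by apply: eq_bigr => j _; rewrite derM !coef_map.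
Qed.

HB.instance Definition _ := hasDerivation.Build {poly R} poly_derD poly_derM.

End PolyDerivation.

(* The differential operator \sum_i a_i d^i, coefficients on the left, is
   represented by the polynomial \sum_i a_i 'X^i, with its own product. *)
Definition diffop (R : diffRingType) : Type := {poly R}.

HB.instance Definition _ (R : diffRingType) := GRing.Zmodule.on (diffop R).

Section DiffOp.
Variable R : diffRingType.
Implicit Types A B C : {poly R}.

(* Left multiplication by d: d (b d^i) = b d^(i+1) + der(b) d^i. *)
Definition diffop_dmul B : {poly R} := B * 'X + poly_der B.

Definition diffop_mul A B : {poly R} :=
  \sum_(i < size A) A`_i *: iter i diffop_dmul B.

Lemma dmul_is_nmod_morphism : nmod_morphism diffop_dmul.
Proof.
split=> [|A B]; rewrite /diffop_dmul; first by rewrite mul0r /poly_der raddf0 addr0.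
by rewrite mulrDl poly_derD addrACA.
Qed.

HB.instance Definition _ :=
  GRing.isNmodMorphism.Build {poly R} {poly R} diffop_dmul dmul_is_nmod_morphism.

Lemma iter_dmulD i : {morph iter i diffop_dmul : A B / A + B}.
Proof. by move=> A B; elim: i => //= i ->; rewrite raddfD. Qed.

Lemma diffop_mulE n A B : (size A <= n)%N ->
  diffop_mul A B = \sum_(i < n) A`_i *: iter i diffop_dmul B.
Proof.
move=> sAn; rewrite /diffop_mul.
rewrite (big_ord_widen n (fun i => A`_i *: iter i diffop_dmul B) sAn).
rewrite big_mkcond; apply: eq_bigr => i _.
by case: ltnP => // /(nth_default 0) ->; rewrite scale0r.
Qed.

Lemma diffop_mulDl A B C :
  diffop_mul (A + B) C = diffop_mul A C + diffop_mul B C.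
Proof.
pose n := maxn (size A) (size B).
rewrite (@diffop_mulE n (A + B)) ?size_polyD //.
rewrite (@diffop_mulE n A) ?leq_maxl // (@diffop_mulE n B) ?leq_maxr //.
by rewrite -big_split; apply: eq_bigr => i _; rewrite coefD scalerDl.
Qed.

Lemma diffop_mulDr A B C :
  diffop_mul A (B + C) = diffop_mul A B + diffop_mul A C.
Proof.
by rewrite -big_split; apply: eq_bigr => i _; rewrite iter_dmulD scalerDr.
Qed.

Lemma diffop_mul0l B : diffop_mul 0 B = 0.
Proof. by rewrite /diffop_mul size_poly0 big_ord0. Qed.

Lemma diffop_mulZl a A B : diffop_mul (a *: A) B = a *: diffop_mul A B.
Proof.
rewrite (@diffop_mulE (size A) (a *: A)) ?size_scale_leq // scaler_sumr.
by apply: eq_bigr => i _; rewrite coefZ scalerA.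
Qed.

Lemma diffop_mul_suml I (s : seq I) (F : I -> {poly R}) B :
  diffop_mul (\sum_(i <- s) F i) B = \sum_(i <- s) diffop_mul (F i) B.
Proof.
by elim: s => [|i s IHs]; rewrite ?big_nil ?diffop_mul0l // !big_cons
  diffop_mulDl IHs.
Qed.

Lemma dmulZ a A :
  diffop_dmul (a *: A) = a *: diffop_dmul A + der a *: A.
Proof.
rewrite /diffop_dmul scalerDr -scalerAl -addrA; congr (_ + _).
by apply/polyP=> i; rewrite !(coefD, coefZ, coef_map) /= derM addrC.
Qed.

Lemma diffop_mul_dmul A B :
  diffop_mul (diffop_dmul A) B = diffop_dmul (diffop_mul A B).
Proof.
pose n := size A.
have szX : (size (A * 'X)%R <= n.+1)%N.
  by rewrite (leq_trans (size_polyMleq _ _)) // size_polyX addn2.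
rewrite {1}/diffop_dmul diffop_mulDl (diffop_mulE _ szX).
rewrite (@diffop_mulE n (poly_der A)) ?size_poly //.
rewrite /diffop_mul raddf_sum big_ord_recl coefMX scale0r add0r -big_split /=.
apply: eq_bigr => i _.
by rewrite coefMX dmulZ coef_map.
Qed.

Lemma diffop_mulA : associative diffop_mul.
Proof.
move=> A B C; rewrite {2}/diffop_mul diffop_mul_suml; apply: eq_bigr => i _.
rewrite diffop_mulZl; congr (_ *: _).
by elim: (nat_of_ord i) => //= k ->; rewrite diffop_mul_dmul.
Qed.

Lemma diffop_mul1l : left_id 1 diffop_mul.
Proof.
by move=> A; rewrite /diffop_mul size_poly1 big_ord1 coef1 scale1r.
Qed.

Lemma diffop_mul1r : right_id 1 diffop_mul.
Proof.
move=> A; rewrite /diffop_mul -[RHS]coefK poly_def.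
apply: eq_bigr => i _; congr (_ *: _).
elim: (nat_of_ord i) => [|k /= ->]; first by rewrite expr0.
rewrite /diffop_dmul /poly_der -exprSr -[RHS]addr0; congr (_ + _).
apply/polyP=> j; rewrite coef_map coefXn coef0 /=.
by case: eqP => _; rewrite ?der1 ?der0.
Qed.

HB.instance Definition _ :=
  GRing.Zmodule_isNzRing.Build (diffop R) diffop_mulA diffop_mul1l
    diffop_mul1r diffop_mulDl diffop_mulDr (oner_neq0 {poly R}).

Definition dop_const (a : R) : diffop R := a%:P.
Definition dop_d : diffop R := 'X.
Definition dop_coef (A : diffop R) (i : nat) : R := (A : {poly R})`_i.
Definition dop_order (A : diffop R) : nat := (size (A : {poly R})).-1.

Lemma dop_d_const a :
  dop_d * dop_const a = dop_const a * dop_d + dop_const (der a).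
Proof.
rewrite /GRing.mul /= /diffop_mul size_polyX big_ord_recl big_ord1 /=.
rewrite !coefX /= scale0r scale1r add0r /diffop_dmul /poly_der map_polyC /=.
have [->|a0] := eqVneq a 0; first by rewrite size_polyC eqxx big_ord0 mul0r.
by rewrite size_polyC a0 big_ord1 coefC eqxx /= mul_polyC.
Qed.

(* For A, B of orders n, m the rows are d^(m-1) A, ..., A, d^(n-1) B, ..., B
   and the columns are indexed by d^(m+n-1), ..., d, 1. *)
Definition dres_mx (A B : diffop R) : 'M[R]_(dop_order B + dop_order A) :=
  let n := dop_order A in let m := dop_order B in
  col_mx
    (\matrix_(i < m, k < m + n) dop_coef (dop_d ^+ rev_ord i * A) (rev_ord k))
    (\matrix_(j < n, k < m + n) dop_coef (dop_d ^+ rev_ord j * B) (rev_ord k)).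

Definition dres (A B : diffop R) : R := \det (dres_mx A B).

End DiffOp.

Section Constants.
Variable K : diffFieldType.

Definition is_const : {pred K} := fun a => der a == 0.

Lemma is_const_divring_closed : divring_closed is_const.
Proof.
split=> [|a b|a b]; rewrite !unfold_in ?der1 //.
  by move=> /eqP da /eqP db; rewrite derD derN da db subrr.
move=> /eqP da /eqP db; rewrite derM da mul0r add0r mulf_eq0.
have [-> | b0] := eqVneq b 0; first by rewrite invr0 der0 eqxx orbT.
apply/orP; right; rewrite -(mulrI_eq0 _ (mulfI b0)).
have := derM b b^-1.
by rewrite mulfV // der1 db mul0r add0r => <-.
Qed.

HB.instance Definition _ :=
  GRing.isDivringClosed.Build K is_const is_const_divring_closed.

(* The field C of constants. *)
Record constants : predArgType :=
  Constant {const_val :> K; _ : const_val \in is_const}.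

HB.instance Definition _ := [isSub for const_val].
HB.instance Definition _ := [Choice of constants by <:].
HB.instance Definition _ := [SubChoice_isSubIntegralDomain of constants by <:].
HB.instance Definition _ := [SubIntegralDomain_isSubField of constants by <:].

(* Membership in the subring C[d] of K[d]. *)
Definition const_coef (A : diffop K) : bool :=
  (A : {poly K}) \is a polyOver is_const.

End Constants.

(* C[lambda,mu] and K[lambda,mu] are the iterated polynomial rings
   {poly {poly _}}; lambda is the inner variable and mu the outer one. *)
Section BurchnallChaundy.
Variable K : diffFieldType.

Definition lambda : {poly {poly K}} := 'X%:P.
Definition mu : {poly {poly K}} := 'X.

Definition const_inj : {poly {poly constants K}} -> {poly {poly K}} :=
  map_poly (map_poly (@const_val K)).

(* K[d] -> K[lambda,mu][d]. *)
Definition dop_lift (A : diffop K) : diffop {poly {poly K}} :=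
  map_poly (fun a : K => a%:P%:P) (A : {poly K}).

(* g(P,Q) = \sum_(i,j) g_ij P^i Q^j with g_ij the coefficient of
   lambda^i mu^j. *)
Definition dop_eval (P Q : diffop K) (g : {poly {poly constants K}}) : diffop K :=
  \sum_(j < size g) \sum_(i < size g`_j)
     dop_const (const_val g`_j`_i) * P ^+ i * Q ^+ j.

Definition BC (P Q : diffop K) : {pred {poly {poly constants K}}} :=
  fun g => dop_eval P Q g == 0.

End BurchnallChaundy.

Section SquareFree.
Variable R : idomainType.

Definition irreducible_elt (p : R) : Prop :=
  [/\ p != 0, p \isn't a GRing.unit
    & forall a b, p = a * b -> a \is a GRing.unit \/ b \is a GRing.unit].

Definition associated (p q : R) : Prop :=
  exists2 u, u \is a GRing.unit & p = u * q.

(* f is a square-free part of h: h = u p_1^(e_1) ... p_r^(e_r), with the p_i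
   pairwise non-associated irreducibles and all e_i positive, and f is
   p_1 ... p_r up to a unit. In K[lambda,mu] the units are the nonzero elements
   of K, so this does not fix the leading coefficient: the resultant of
   operators that are not monic need not have constant coefficients (it is
   x (lambda - mu) for P = Q = x d), although its square-free part has a
   representative with constant coefficients. *)
Definition squarefree_part (f h : R) : Prop :=
  exists (r : nat) (p : 'I_r -> R) (e : 'I_r -> nat),
  [/\ forall i, irreducible_elt (p i) /\ (0 < e i)%N,
      forall i j, i != j -> ~ associated (p i) (p j),
      associated h (\prod_(i < r) p i ^+ e i)
    & associated f (\prod_(i < r) p i)].

End SquareFree.

(* Main.v *)
From HB Require Import structures.
Require Import Defs.
From Stdlib Require Import Classical.
From mathcomp Require Import all_boot all_order all_fingroup all_algebra.

(** Let n be the order of P. Right multiplication by P commutes with left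
    multiplication by K, so it makes D = K[d] a K[lambda]-module, and comparing
    leading terms shows that D is free with basis 1, d, ..., d^(n-1). Since Q
    commutes with P, right multiplication by Q is a K[lambda]-linear
    endomorphism of D; let B be its matrix and chi(lambda, mu) its
    characteristic polynomial. Everything follows from chi.

    - The resultant h is chi up to a nonzero factor from K ([dres_lift_sub]):
      the rows of the resultant matrix are operators over K[lambda, mu], and
      modulo P - lambda those coming from P - lambda vanish while those coming
      from Q - mu become the rows of B - mu.

    - The coefficients of chi are constants ([der_char_poly_mulr_mx]). Left
      multiplication by d is a connection on the module D, and it commutes with
      right multiplication by Q. In coordinates this says that the derivative
      of B is a commutator [N, B], and by Jacobi's formula the determinant of
      B - mu then has derivative tr (adj (B - mu) [N, B - mu]) = 0.

    - A polynomial g with constant coefficients lies in BC(P, Q) if and only if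
      g(lambda, B) = 0 ([BC_horner_mx]), because g(lambda, B) is the matrix of
      right multiplication by g(P, Q). By Cayley-Hamilton chi is in BC(P, Q),
      and BC(P, Q) is a prime ideal since D is a domain. In characteristic zero
      an irreducible factor over K, monic in mu, of a polynomial with constant
      coefficients has constant coefficients too ([der_monic_factor]); hence
      BC(P, Q) contains a polynomial f, monic in mu, that is irreducible over K
      ([exists_monic_irreducible_BC]).

    - If g(lambda, B) = 0, then B - mu divides the scalar matrix g(lambda, mu),
      and taking determinants chi divides g^n ([char_poly_dvd_exp]). With g = f
      this shows that chi is a power of f, as f is prime in K[lambda, mu] by
      Gauss's lemma ([monic_irreducible_prime]). For g in BC(P, Q) it shows
      that f divides g^n, hence g, over K; the quotient is again annihilated by
      the derivation, so it has constant coefficients. Thus BC(P, Q) = (f).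

    So h is a unit times a power of f, and f is, up to a unit, its only
    square-free part ([squarefree_part_prime_power]). *)

Set Implicit Arguments.
Unset Strict Implicit.
Unset Printing Implicit Defensive.

Import GRing.Theory Pdiv.Idomain.
Local Open Scope ring_scope.

(** * Monic polynomials over F[x] *)

Definition prime_elt (R : idomainType) (f : R) : Prop := forall a b,
  (exists q, a * b = q * f) -> (exists q, a = q * f) \/ (exists q, b = q * f).

Lemma exists_min_size (R : nzSemiRingType) (A : {poly R} -> Prop) :
  (exists p, A p) ->
  exists2 p, A p & forall q, A q -> (size p <= size q)%N.
Proof.
case=> p; have [n] := ubnP (size p); elim: n p => // n IH p szp Ap.
have [[q [Aq ltqp]]|nq] := classic (exists q, A q /\ (size q < size p)%N).
  by apply: (IH q) => //; apply: leq_trans ltqp _.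
exists p => // q Aq; rewrite leqNgt; apply/negP => ltqp.
by apply: nq; exists q.
Qed.

Lemma exists_irreducible_factor (F : fieldType) (p : {poly F}) :
  p != 0 -> (1 < size p)%N -> exists2 q : {poly F}, irreducible_poly q & q %| p.
Proof.
move=> p0 szp.
have [|q [szq dvdq] qmin] :=
  @exists_min_size _ (fun q : {poly F} => (1 < size q)%N /\ q %| p).
  by exists p.
exists q => //; split=> // r szr dvdr.
have q0 : q != 0 by rewrite -size_poly_gt0 ltnW.
have r0 : r != 0 by apply: contraTneq dvdr => ->; rewrite dvd0p.
rewrite -dvdp_size_eqp // eqn_leq dvdp_leq // qmin //; split.
  by rewrite ltn_neqAle eq_sym szr size_poly_gt0.
exact: dvdp_trans dvdq.
Qed.

Lemma irreducible_poly_primeM (F : fieldType) (p a b : {poly F}) :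
  irreducible_poly p -> p %| a * b -> (p %| a) || (p %| b).
Proof.
move=> irr; case: (boolP (p %| a)) => //= na.
by rewrite Gauss_dvdpr // irreducible_poly_coprime.
Qed.

(** The reduction of F[x][y] modulo p is a polynomial ring over a domain. Here
    this is unrolled as an induction that removes leading terms: p divides the
    product of the two leading coefficients, hence one of them. *)
Lemma irreducible_dvd_coefM (F : fieldType) (p : {poly F})
    (a b : {poly {poly F}}) :
  irreducible_poly p -> (forall i, p %| (a * b)`_i) ->
  (forall i, p %| a`_i) \/ (forall i, p %| b`_i).
Proof.
move=> irr; have [n] := ubnP (size a + size b).
elim: n a b => // n IH a b szn dvdab.
have [->|a0] := eqVneq a 0; first by left=> i; rewrite coef0.
have [->|b0] := eqVneq b 0; first by right=> i; rewrite coef0.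
have drop_lead (u : {poly {poly F}}) : u != 0 ->
    exists2 v : {poly {poly F}}, (size v < size u)%N
      & u = v + lead_coef u *: 'X^((size u).-1).
  move=> u0; exists (u - lead_coef u *: 'X^((size u).-1)); last by rewrite subrK.
  rewrite -[X in (_ < X)%N](@prednK (size u)) ?size_poly_gt0 // ltnS.
  apply/leq_sizeP => j; rewrite leq_eqVlt => /orP[/eqP<-|ltj].
    by rewrite coefB coefZ coefXn eqxx mulr1 subrr.
  rewrite coefB coefZ coefXn gtn_eqF // mulr0 subr0 nth_default //.
  by rewrite -[size u](@prednK) ?size_poly_gt0.
have := dvdab (size (a * b)).-1.
rewrite -/(lead_coef _) lead_coefM => /(irreducible_poly_primeM irr) /orP[] dvdl.
- have [v ltv eqa] := drop_lead a a0.
  case: (IH v b) => [|i|dv|]; last by right.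
  + by rewrite -ltnS (leq_ltn_trans _ szn) // ltn_add2r.
  + have -> : v = a - lead_coef a *: 'X^((size a).-1) by rewrite {1}eqa addrK.
    rewrite mulrBl coefB dvdp_sub // -scalerAl coefZ.
    by rewrite dvdp_mulr.
  + by left=> i; rewrite eqa coefD coefZ dvdp_add ?dvdp_mulr.
- have [v ltv eqb] := drop_lead b b0.
  case: (IH a v) => [|i||dv]; last 1 first.
  + by right=> i; rewrite eqb coefD coefZ dvdp_add ?dvdp_mulr.
  + by rewrite -ltnS (leq_ltn_trans _ szn) // ltn_add2l.
  + have -> : v = b - lead_coef b *: 'X^((size b).-1) by rewrite {1}eqb addrK.
    rewrite mulrBr coefB dvdp_sub // -scalerAr coefZ.
    by rewrite dvdp_mulr.
  + by left.
Qed.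

Lemma dvd_coefP (F : fieldType) (p : {poly F}) (a : {poly {poly F}}) :
  (forall i, p %| a`_i) -> exists b, a = p *: b.
Proof.
move=> dv; exists (\poly_(i < size a) (a`_i %/ p)).
apply/polyP=> i; rewrite coefZ coef_poly; case: ltnP => [_|/(nth_default 0) ->].
  by rewrite mulrC Pdiv.Field.divpK.
by rewrite mulr0.
Qed.

(** Gauss's lemma in the form needed for pseudo-division: the irreducible
    factors of the scalar c can be moved one at a time into a or b, which
    changes neither degree in y. *)
Lemma primitive_factors (F : fieldType) (f a b : {poly {poly F}}) (c : {poly F}) :
  c != 0 -> c *: f = a * b ->
  exists a' b', [/\ f = a' * b', size a' = size a & size b' = size b].
Proof.
have [n] := ubnP (size c); elim: n c a b => // n IH c a b szn c0 eqc.
have [szc|szc] := leqP (size c) 1.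
  have /size_poly1P[k k0 eqk] : size c == 1.
    by rewrite eqn_leq szc size_poly_gt0.
  exists (k^-1%:P *: a), b; split=> //; last first.
    by rewrite size_scale // polyC_eq0 invr_eq0.
  by rewrite -scalerAl -eqc eqk scalerA -polyCM mulVf // scale1r.
have [p irr /Pdiv.Field.dvdpP[d eqd]] := exists_irreducible_factor c0 szc.
have p0 := irredp_neq0 irr.
have d0 : d != 0 by apply: contraNneq c0 => d0; rewrite eqd d0 mul0r.
have ltd : (size d < n)%N.
  apply: leq_trans (_ : (size c <= n)%N) => //.
  rewrite eqd size_mul //; case: irr => sz1 _.
  by case: (size p) sz1 => [|[|k]] // _; rewrite !addnS /= ltnS leq_addr.
have dvdab i : p %| (a * b)`_i.
  by rewrite -eqc coefZ eqd -mulrA dvdp_mull // dvdp_mulr.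
have cancel_p (u v : {poly {poly F}}) : p *: u = p *: v -> u = v.
  by rewrite -!mul_polyC => /mulfI; apply; rewrite polyC_eq0.
have eqp : p *: (d *: f) = a * b by rewrite scalerA mulrC -eqd.
have [/dvd_coefP[a1 eqa]|/dvd_coefP[b1 eqb]] := irreducible_dvd_coefM irr dvdab.
- have [|a' [b' [-> sa sb]]] := IH d a1 b ltd d0.
    by apply: cancel_p; rewrite eqp eqa -scalerAl.
  by exists a', b'; split; rewrite // sa eqa size_scale.
- have [|a' [b' [-> sa sb]]] := IH d a b1 ltd d0.
    by apply: cancel_p; rewrite eqp eqb -scalerAr.
  by exists a', b'; split; rewrite // sb eqb size_scale.
Qed.

(** Over the domain F[x], gcdp divides f only up to a scalar, but
    Gauss's lemma removes the scalar: by irreducibility the gcd of f and a has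
    degree 0 in y, or the same degree as f. *)
Lemma monic_irreducible_prime (F : fieldType) (f a b : {poly {poly F}}) :
  f \is monic -> irreducible_elt f -> f %| a * b -> f %| a \/ f %| b.
Proof.
move=> monf [_ _ irr] dvdab.
have /dvdpP[[c q]] /= := dvdp_gcdl f a.
set d := gcdp f a; case=> [c0 eqc].
have [u [v [eqf su sv]]] := primitive_factors c0 eqc.
have size_unit (w : {poly {poly F}}) : w \is a GRing.unit -> (size w <= 1)%N.
  by rewrite poly_unitE => /andP[/eqP->].
have [/size_unit szu|/size_unit szv] := irr _ _ eqf.
- left; rewrite (dvdp_trans _ (dvdp_gcdr f a)) // -/d.
  have q0 : q != 0.
    apply: contraTneq (monic_neq0 monf) => q0; move/eqP: eqc.
    by rewrite q0 mul0r -mul_polyC mulf_eq0 polyC_eq0 (negPf c0) negbK.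
  have /size_poly1P[k k0 eqk] : size q == 1.
    by rewrite eqn_leq -su szu su size_poly_gt0.
  have -> : f %| d = (f %| k *: d) by rewrite dvdpZr.
  by rewrite -mul_polyC -eqk -eqc dvdpZr // dvdpp.
- right; rewrite -(@Gauss_dvdpr _ b a) // coprimep_def.
  rewrite eqn_leq -/d -sv szv sv size_poly_gt0.
  by rewrite gcdp_eq0 negb_and monic_neq0.
Qed.

Lemma monic_irreducible_prime_elt (F : fieldType) (f : {poly {poly F}}) :
  f \is monic -> irreducible_elt f -> prime_elt f.
Proof.
move=> monf irrf a b /(Pdiv.IdomainMonic.dvdpP monf).
case/(monic_irreducible_prime monf irrf) => /(Pdiv.IdomainMonic.dvdpP monf).
  by left.
by right.
Qed.

Lemma monic_size_gt1 (R : nzRingType) (p : {poly R}) :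
  p \is monic -> p != 1 -> (1 < size p)%N.
Proof.
move=> monp p1; rewrite ltnNge; apply: contraNN p1 => /size1_polyC eqp.
by move: monp; rewrite monicE eqp lead_coefC => /eqP->.
Qed.

Lemma monic_associated (F : fieldType) (p q : {poly {poly F}}) :
  p \is monic -> q \is monic -> associated p q -> p = q.
Proof.
move=> monp monq [u]; rewrite poly_unitE => /andP[su _] eqp.
have equ : u = (u`_0)%:P by apply: size1_polyC; rewrite (eqP su).
suff -> : p = 1 * q by rewrite mul1r.
rewrite eqp equ; congr (_ * _); rewrite -polyC1; congr (_%:P).
by move: monp; rewrite monicE eqp lead_coefM (eqP monq) mulr1 {1}equ lead_coefC => /eqP.
Qed.

(** Take a monic divisor of least positive degree. In a factorization of a
    monic polynomial the leading coefficients are units, so they can be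
    normalized away. *)
Lemma exists_monic_irreducible_factor (F : fieldType) (p : {poly {poly F}}) :
  p \is monic -> (1 < size p)%N ->
  exists g q : {poly {poly F}},
    [/\ g \is monic, q \is monic, irreducible_elt g & p = g * q].
Proof.
move=> monp szp.
have [|g [szg mong [q eqp]] gmin] := @exists_min_size _
  (fun g : {poly {poly F}} =>
     [/\ (1 < size g)%N, g \is monic & exists q, p = g * q]).
  by exists p; split=> //; exists 1; rewrite mulr1.
exists g, q; split=> //; first by move: monp; rewrite eqp monicMl.
split; first exact: monic_neq0.
  by rewrite poly_unitE gtn_eqF.
move=> a b eqg.
have lab : lead_coef a * lead_coef b = 1.
  by rewrite -lead_coefM -eqg; apply/eqP.
have ua : lead_coef a \is a GRing.unit.
  by apply/unitrPr; exists (lead_coef b).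
have ub : lead_coef b \is a GRing.unit.
  by apply/unitrPr; exists (lead_coef a); rewrite mulrC.
have a0 : a != 0 by rewrite -lead_coef_eq0; apply: contraTneq ua => ->; rewrite unitr0.
have b0 : b != 0 by rewrite -lead_coef_eq0; apply: contraTneq ub => ->; rewrite unitr0.
have unit1 (w : {poly {poly F}}) :
    w != 0 -> lead_coef w \is a GRing.unit -> (size w <= 1)%N -> w \is a GRing.unit.
  move=> w0 uw szw; have sz1 : size w == 1 by rewrite eqn_leq szw size_poly_gt0.
  by rewrite poly_unitE sz1; rewrite lead_coefE (eqP sz1) in uw.
have [sza|sza] := leqP (size a) 1; first by left; apply: unit1.
have [szb|szb] := leqP (size b) 1; first by right; apply: unit1.
(* Normalizing a gives a monic divisor of p smaller than g. *)
suff: false by [].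
have := gmin (lead_coef b *: a); rewrite size_scale ?lead_coef_eq0 //.
have -> : (size g <= size a)%N = false.
  rewrite eqg size_mul //; case: (size b) szb => [|[|k]] // _.
  by rewrite !addnS /= leqNgt ltnS leq_addr.
apply; split=> //.
  by rewrite monicE lead_coefZ mulrC lab.
exists (lead_coef a *: b * q); rewrite mulrA -scalerAl -scalerAr scalerA.
by rewrite [_ * lead_coef a]mulrC lab scale1r -eqg.
Qed.

(** * Powers of a prime element and their square-free parts *)

Lemma irreducible_associated (R : idomainType) (p q : R) :
  associated p q -> irreducible_elt q -> irreducible_elt p.
Proof.
move=> [u uu ->] [q0 nuq irrq]; split.
- by rewrite mulf_neq0 //; apply: contraTneq uu => ->; rewrite unitr0.
- by rewrite unitrM uu.
- move=> a b eqab; have [|ua|ub] := irrq (u^-1 * a) b; last by right.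
    by rewrite -mulrA -eqab mulKr.
  by left; rewrite unitrM unitrV uu in ua.
Qed.

Section PrimePower.
Variables (R : idomainType) (f : R).
Hypothesis irrf : irreducible_elt f.
Hypothesis primef : prime_elt f.

(** Distribute the k factors f between a and b, one at a time, using that f
    is prime. *)
Lemma factor_prime_power u k a b :
  u \is a GRing.unit -> a * b = u * f ^+ k -> exists j, associated a (f ^+ j).
Proof.
move=> uu; elim: k a b => [|k IH] a b eqab.
  exists 0; exists a; rewrite ?expr0 ?mulr1 //.
  by rewrite expr0 mulr1 in eqab; rewrite -eqab unitrM in uu; case/andP: uu.
have f0 : f != 0 by case: irrf.
have [|[q eqa]|[q eqb]] := @primef a b.
- by exists (u * f ^+ k); rewrite eqab exprSr mulrA.
- have [|j [v uv eqq]] := IH q b.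
    by apply: (mulIf f0); rewrite -[RHS]mulrA -exprSr -eqab eqa mulrAC.
  by exists j.+1, v; rewrite // exprSr mulrA -eqq.
- by apply: (IH a q); apply: (mulIf f0); rewrite -[RHS]mulrA -exprSr -eqab eqb mulrA.
Qed.

Lemma irreducible_factor_prime_power u k a b :
  u \is a GRing.unit -> a * b = u * f ^+ k -> irreducible_elt a ->
  associated a f.
Proof.
move=> uu eqab [a0 nua irra]; have [j [v uv eqa]] := factor_prime_power uu eqab.
case: irrf => f0 nuf _; case: j eqa => [|j] eqa.
  by rewrite eqa expr0 mulr1 uv in nua.
case: (irra (v * f) (f ^+ j)); first by rewrite -mulrA -exprS.
  by rewrite unitrM (negPf nuf) andbF.
case: j eqa => [|j] eqa; first by exists v.
by rewrite exprS unitrM (negPf nuf).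
Qed.

(** Each irreducible in the factorization of a power of f is associated
    to f; as the irreducibles are pairwise non-associated, there is only one. *)
Lemma squarefree_part_prime_power h k :
  associated h (f ^+ k.+1) ->
  squarefree_part f h /\ forall g, squarefree_part g h -> associated g f.
Proof.
move=> [u uu eqh]; split.
  exists 1%N, (fun=> f), (fun=> k.+1); split=> //.
  - by move=> i j; rewrite !ord1.
  - by exists u; rewrite // big_ord1.
  - by exists 1; rewrite ?unitr1 // big_ord1 mul1r.
move=> g [r [p [e [irrp npp [v uv eqh'] [w uw eqg]]]]].
have assoc i : associated (p i) f.
  have [irrpi ei] := irrp i.
  apply: (@irreducible_factor_prime_power u k.+1 _
    (v * (p i ^+ (e i).-1 * \prod_(j < r | j != i) p j ^+ e j))) => //.
  rewrite -eqh eqh' [in RHS](bigD1 i) //= -[in RHS](prednK ei) exprS.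
  by rewrite mulrCA -!mulrA.
have [f0 nuf _] := irrf.
case: r p e irrp npp eqh' eqg assoc => [|[|r]] p e irrp npp eqh' eqg assoc.
- have uh : h \is a GRing.unit by rewrite eqh' big_ord0 mulr1.
  by rewrite eqh exprS !unitrM (negPf nuf) andbF in uh.
- rewrite big_ord1 in eqg; have [v' uv' eqp] := assoc ord0.
  by exists (w * v'); rewrite ?unitrM ?uw // eqg eqp mulrA.
- case: (npp ord0 ord_max) => //.
  have [a ua eqa] := assoc ord0; have [b ub eqb] := assoc ord_max.
  by exists (a / b); rewrite ?unitrM ?unitrV ?ua // eqa eqb mulrA divrK.
Qed.

End PrimePower.

(** * Derivations, determinants and constants *)

Section DerivationFacts.
Variable R : diffRingType.

Lemma der_exp (a : R) k : der (a ^+ k.+1) = (a ^+ k * der a) *+ k.+1.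
Proof.
elim: k => [|k IH]; first by rewrite expr1 expr0 mul1r.
by rewrite exprS derM IH mulrnAr mulrA -exprS [der a * _]mulrC -mulrS.
Qed.

Lemma der_prod (I : eqType) (s : seq I) (F : I -> R) : uniq s ->
  der (\prod_(i <- s) F i)
  = \sum_(i <- s) \prod_(j <- s) (if j == i then der (F j) else F j).
Proof.
elim: s => [|i s IH] /=; first by rewrite !big_nil der1.
case/andP=> nis us; rewrite big_cons derM IH // [RHS]big_cons; congr (_ + _).
  rewrite big_cons eqxx; congr (_ * _); apply: eq_big_seq => j js.
  by case: eqP js nis => // -> ->.
rewrite mulr_sumr; apply: eq_big_seq => j js; rewrite big_cons.
by case: eqP js nis => // -> ->.
Qed.

(** Jacobi's formula. By the Leibniz rule the derivative of the determinant
    is the sum over i of the determinants with row i differentiated; expand the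
    i-th one along row i. *)
Lemma der_det n (M : 'M[R]_n) : der (\det M) = \tr (\adj M *m map_mx der M).
Proof.
pose Mi i : 'M[R]_n := \matrix_(k, j) if k == i then der (M k j) else M k j.
transitivity (\sum_i \det (Mi i)).
  rewrite raddf_sum /= exchange_big /=; apply: eq_bigr => s _.
  rewrite derM (_ : der (_ ^+ _) = 0) ?mul0r ?add0r; last first.
    by case: (perm.odd_perm s); rewrite ?expr0 ?expr1 ?derN der1 ?oppr0.
  rewrite der_prod ?index_enum_uniq // -mulr_sumr; congr (_ * _).
  by apply: eq_bigr => i _; apply: eq_bigr => k _; rewrite mxE.
rewrite mxtrace_mulC; apply: eq_bigr => i _; rewrite (expand_det_row _ i) mxE.
apply: eq_bigr => j _; rewrite !mxE eqxx; congr (_ * _).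
rewrite /cofactor; congr (_ * \det _); apply/matrixP=> k l; rewrite !mxE.
by rewrite eq_sym (negPf (neq_lift _ _)).
Qed.

(** Both tr (adj M * N * M) and tr (adj M * M * N) are det M * tr N. *)
Lemma der_det_commutator n (M N : 'M[R]_n) :
  map_mx der M = N *m M - M *m N -> der (\det M) = 0.
Proof.
move=> dM; rewrite der_det dM mulmxBr raddfB /= !mulmxA mul_adj_mx.
by rewrite mxtrace_mulC mulmxA mul_mx_adj subrr.
Qed.

End DerivationFacts.

Lemma coef_poly_der (R : diffRingType) (A : {poly R}) k :
  (poly_der A)`_k = der A`_k.
Proof. exact: coef_map. Qed.

Lemma der_polyC (R : diffRingType) (a : R) : der (a%:P) = (der a)%:P.
Proof. by rewrite -[LHS]/(map_poly _ _) map_polyC. Qed.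

Lemma der_polyX (R : diffRingType) : der ('X : {poly R}) = 0.
Proof.
apply/polyP=> k; rewrite coef_map coefX coef0 /=.
by case: (k == _); rewrite ?der1 ?der0.
Qed.

Section ConstantPolynomials.
Variable K : diffFieldType.
Local Notation C := (constants K).
Local Notation KXY := {poly {poly K}}.
Local Notation CXY := {poly {poly C}}.

HB.instance Definition _ :=
  GRing.RMorphism.copy (@const_val K) (\val : {rmorphism C -> K}).
HB.instance Definition _ := GRing.RMorphism.on (@const_inj K).

Lemma coef_const_inj (g : CXY) i j :
  (const_inj g)`_j`_i = const_val g`_j`_i.
Proof. by rewrite /const_inj !coef_map. Qed.

Lemma der_coef2 (p : KXY) i j : (der p)`_j`_i = der p`_j`_i.
Proof. by rewrite !coef_map. Qed.

Lemma der_const_val (c : C) : der (const_val c) = 0.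
Proof. by apply/eqP; case: c. Qed.

Lemma der_const_inj (g : CXY) : der (const_inj g) = 0.
Proof.
apply/polyP=> j; apply/polyP=> i.
by rewrite der_coef2 coef_const_inj der_const_val !coef0.
Qed.

Lemma der0_const_inj (p : KXY) : der p = 0 -> exists g, const_inj g = p.
Proof.
move=> dp.
have dpij i j : p`_j`_i \in @is_const K.
  by apply/eqP; rewrite -der_coef2 dp !coef0.
exists (\poly_(j < size p) \poly_(i < size p`_j) Constant (dpij i j)).
apply/polyP=> j; apply/polyP=> i; rewrite coef_const_inj coef_poly.
case: ltnP => [_|/(nth_default 0) ->]; last by rewrite !coef0.
by rewrite coef_poly; case: ltnP => [_|/(nth_default 0) ->].
Qed.

Lemma const_inj_inj : injective (@const_inj K).
Proof.
move=> g1 g2 eqg; apply/polyP=> j; apply/polyP=> i; apply: val_inj => /=.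
by rewrite -!coef_const_inj eqg.
Qed.

Lemma size_const_inj (g : CXY) : size (const_inj g) = size g.
Proof.
apply: size_map_inj_poly; rewrite ?rmorph0 // => a b eqab.
by apply/polyP=> i; apply: val_inj; rewrite /= -!coef_map eqab.
Qed.

Lemma unit_const_inj (g : CXY) :
  const_inj g \is a GRing.unit -> g \is a GRing.unit.
Proof.
rewrite !poly_unitE size_const_inj /const_inj coef_map /=.
rewrite size_map_inj_poly ?rmorph0 //; last exact: val_inj.
rewrite coef_map /= !unitfE => /and3P[-> -> /= g0].
by apply: contraNneq g0 => ->; rewrite rmorph0.
Qed.

Lemma irreducible_const_inj (g : CXY) :
  irreducible_elt (const_inj g) -> irreducible_elt g.
Proof.
case=> g0 nug irr; split.
- by apply: contraNneq g0 => ->; rewrite rmorph0.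
- by apply: contraNN nug => /(rmorph_unit (@const_inj K)).
- move=> a b eqg; have := irr (const_inj a) (const_inj b).
  by rewrite eqg rmorphM => /(_ erefl) [] /unit_const_inj; [left|right].
Qed.

Lemma der0_cofactor (f q : KXY) :
  f \is monic -> der f = 0 -> der (q * f) = 0 -> der q = 0.
Proof.
move=> monf df; rewrite derM df mulr0 addr0 => /eqP.
by rewrite mulf_eq0 (negPf (monic_neq0 monf)) orbF => /eqP.
Qed.

Lemma size_der_monic (g : KXY) : g \is monic -> (size (der g) < size g)%N.
Proof.
move=> mong; have g0 := monic_neq0 mong.
rewrite -[size g]prednK ?size_poly_gt0 // ltnS; apply/leq_sizeP => j.
rewrite leq_eqVlt => /orP[/eqP<-|ltj]; rewrite coef_map /=.
  by rewrite -lead_coefE (eqP mong) der1.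
by rewrite nth_default ?der0 // -[size g]prednK ?size_poly_gt0.
Qed.

Lemma monic_multiplicity (g p : KXY) : g \is monic -> (1 < size g)%N -> p != 0 ->
  exists e b, p = g ^+ e * b /\ ~~ (g %| b).
Proof.
move=> mong szg; have [n] := ubnP (size p); elim: n p => // n IH p szn p0.
case: (boolP (g %| p)) => [|ndv]; last by exists 0, p; rewrite expr0 mul1r.
move/(Pdiv.IdomainMonic.dvdpP mong) => [q eqp].
have q0 : q != 0 by apply: contraNneq p0 => q0; rewrite eqp q0 mul0r.
have [|//|e [b [eqq ndv]]] := IH q.
  rewrite -ltnS; apply: leq_ltn_trans szn.
  rewrite eqp size_mul ?(monic_neq0 mong) //; case: (size g) szg => [|[|k]] // _.
  by rewrite !addnS /= ltnS leq_addr.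
by exists e.+1, b; split; rewrite // eqp eqq exprS mulrC mulrA.
Qed.

Hypothesis charC : [pchar C] =i pred0.

Lemma natr_KX_neq0 k : k.+1%:R != 0 :> {poly K}.
Proof.
rewrite -polyC_natr polyC_eq0 -(rmorph_nat (@const_val K)) fmorph_eq0.
by rewrite (pcharf0P _).1.
Qed.

(** Write the polynomial as g^(e+1) * b with b prime to g. Its derivative is
    g^e * ((e+1) der g * b + g * der b), so if it vanishes then g divides
    (e+1) der g * b. In characteristic zero this forces g to divide der g, which
    has smaller degree in y because g is monic. *)
Lemma der_monic_factor (g q : KXY) :
  g \is monic -> irreducible_elt g -> q != 0 -> der (g * q) = 0 -> der g = 0.
Proof.
move=> mong irrg q0 dp; have [g0 nug _] := irrg.
have szg : (1 < size g)%N.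
  apply: monic_size_gt1 => //.
  by apply: contraNneq nug => ->; rewrite unitr1.
have [e [b [eqp ndv]]] := monic_multiplicity mong szg (mulf_neq0 g0 q0).
case: e eqp => [|e] eqp.
  by rewrite -[b]mul1r -[1](expr0 g) -eqp dvdp_mulr in ndv.
have gdv : g %| b * (der g *+ e.+1).
  apply/(Pdiv.IdomainMonic.dvdpP mong); exists (- der b).
  apply: (mulfI (expf_neq0 e g0)); apply/eqP; rewrite -subr_eq0; apply/eqP.
  rewrite -[RHS]dp eqp derM der_exp exprSr -!mulrnAr mulNr !mulrN opprK.
  by congr (_ + _); rewrite mulrCA mulrC -!mulrA // [g * _]mulrC.
have [|gdv1] := monic_irreducible_prime mong irrg gdv; first by move/negP: ndv.
rewrite -scaler_nat dvdpZr ?natr_KX_neq0 // in gdv1.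
apply/eqP; apply: contraTT gdv1 => dg0; apply/negP => /(dvdp_leq dg0).
by rewrite leqNgt size_der_monic.
Qed.

End ConstantPolynomials.

(** * Differential operators *)

(** The elimination step of right division by P, see
    [from_coord_surj]. *)
Lemma size_cancel_lead (F : fieldType) (A T : {poly F}) :
  A != 0 -> size A = size T ->
  (size (A - (lead_coef A / lead_coef T) *: T)%R < size A)%N.
Proof.
move=> A0 sAT; have T0 : T != 0 by rewrite -size_poly_gt0 -sAT size_poly_gt0.
have sA : (0 < size A)%N by rewrite size_poly_gt0.
rewrite -(prednK sA) ltnS; apply/leq_sizeP => j.
rewrite leq_eqVlt coefB coefZ => /orP[/eqP<-|ltj].
  rewrite {2}sAT -!lead_coefE divfK ?subrr // lead_coef_eq0 //.
by rewrite !nth_default ?mulr0 ?subr0 // -?sAT -(prednK sA).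
Qed.

HB.instance Definition _ (R : diffRingType) :=
  GRing.Lmodule.copy (diffop R) {poly R}.
HB.instance Definition _ (R : diffRingType) :=
  GRing.Lmodule_isLalgebra.Build R (diffop R)
    (fun a A B => esym (@diffop_mulZl R a A B)).

Section Operators.
Variable R : diffRingType.
Implicit Types A B : diffop R.

Lemma dop_dM A : dop_d R * A = diffop_dmul A.
Proof.
rewrite /GRing.mul /= (@diffop_mulE _ 2) ?size_polyX //.
by rewrite big_ord_recl big_ord1 !coefX /= scale0r add0r scale1r.
Qed.

Lemma dop_dXE i : dop_d R ^+ i = 'X^i :> {poly R}.
Proof.
elim: i => [|i IH]; first by rewrite expr0.
rewrite exprS dop_dM IH /diffop_dmul -exprSr; apply/polyP=> j.
by rewrite coefD coef_map /= !coefXn; case: (j == i); rewrite ?der1 ?der0 addr0.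
Qed.

Lemma dop_dZ a A : dop_d R * (a *: A) = a *: (dop_d R * A) + der a *: A.
Proof. by rewrite !dop_dM dmulZ. Qed.

Lemma dop_expansion A : A = \sum_(i < size (A : {poly R})) A`_i *: dop_d R ^+ i.
Proof.
rewrite -[LHS]coefK poly_def.
by apply: eq_bigr => i _; rewrite -dop_dXE.
Qed.

(** Constants are central in R[d]. *)
Lemma mul_dop_const a A : der a = 0 -> A * dop_const a = a *: A.
Proof.
move=> da; rewrite [in RHS](dop_expansion A) scaler_sumr.
rewrite {1}/GRing.mul /= /diffop_mul; apply: eq_bigr => i _.
rewrite scalerA [a * _]mulrC -scalerA; congr (_ *: _); rewrite dop_dXE.
elim: (nat_of_ord i) => [|k /= ->]; first by rewrite expr0 alg_polyC.
rewrite dmulZ da scale0r addr0 -dop_dXE -dop_dM -exprS; congr (_ *: _).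
by rewrite -dop_dXE.
Qed.

End Operators.

Section OperatorsOverField.
Variable K : diffFieldType.
Implicit Types A B : diffop K.

Lemma size_iter_dmul i (A : {poly K}) : A != 0 ->
  size (iter i (@diffop_dmul K) A) = (size A + i)%N.
Proof.
move=> A0; elim: i => [|i IH] /=; first by rewrite addn0.
rewrite addnS -IH; set B := iter _ _ _; have B0 : B != 0.
  by rewrite -size_poly_gt0 IH addn_gt0 size_poly_gt0 A0.
rewrite /diffop_dmul size_polyDl size_mulX // ltnS.
exact: size_poly.
Qed.

Lemma size_dopM A B : A != 0 -> B != 0 ->
  size (A * B : {poly K}) = (size (A : {poly K}) + size (B : {poly K})).-1.
Proof.
move=> A0 B0; have: lead_coef (A : {poly K}) != 0 by rewrite lead_coef_eq0.
rewrite lead_coefE {1}/GRing.mul /= /diffop_mul.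
have: (0 < size (A : {poly K}))%N by rewrite size_poly_gt0.
case: (size _) => // k _ /= lA; rewrite big_ord_recr /= addrC size_polyDl.
  by rewrite size_scale // size_iter_dmul // addnC.
rewrite size_scale // size_iter_dmul //.
apply: leq_ltn_trans (size_sum _ _ _) _.
have sB : (0 < size (B : {poly K}))%N by rewrite size_poly_gt0.
rewrite -(prednK sB) addSn ltnS; apply/bigmax_leqP => i _.
apply: leq_trans (size_scale_leq _ _) _; rewrite size_iter_dmul //.
by rewrite -(prednK sB) addSn -addnS leq_add2l.
Qed.

Lemma dop_mul_eq0 A B : A * B = 0 -> A = 0 \/ B = 0.
Proof.
move=> AB0; have [->|A0] := eqVneq A 0; first by left.
have [->|B0] := eqVneq B 0; first by right.
have := size_dopM A0 B0; rewrite AB0 size_poly0.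
have: (0 < size (A : {poly K}))%N by rewrite size_poly_gt0.
have: (0 < size (B : {poly K}))%N by rewrite size_poly_gt0.
by case: (size _) => // k _; case: (size _) => // l _; rewrite addnS.
Qed.

End OperatorsOverField.

(** * The module of operators over K[lambda] *)

(** K[d] as a left K[lambda]-module, lambda acting by right multiplication
    by P; an alias, because the action depends on P. It is a module because
    left multiplication by K commutes with right multiplication by P. *)
Definition opmod (K : diffFieldType) (P : diffop K) : Type := diffop K.

HB.instance Definition _ (K : diffFieldType) (P : diffop K) :=
  GRing.Zmodule.on (opmod P).

Section OperatorModule.
Variables (K : diffFieldType) (P : diffop K).
Local Notation D := (diffop K).
Local Notation opmod := (opmod P).

Implicit Types (r s : {poly K}) (A B : opmod).

Definition opmod_scale (r : {poly K}) (A : opmod) : opmod :=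
  \sum_(k < size r) r`_k *: ((A : D) * P ^+ k).

Lemma opmod_scaleE N r A : (size r <= N)%N ->
  opmod_scale r A = \sum_(k < N) r`_k *: ((A : D) * P ^+ k).
Proof.
move=> srN; rewrite /opmod_scale.
rewrite (big_ord_widen N (fun k => r`_k *: ((A : D) * P ^+ k)) srN).
rewrite big_mkcond; apply: eq_bigr => i _.
by case: ltnP => // /(nth_default 0) ->; rewrite scale0r.
Qed.

Lemma opmod_scaleDl A : {morph opmod_scale^~ A : r s / r + s}.
Proof.
move=> r s; pose N := maxn (size r) (size s).
rewrite (@opmod_scaleE N (r + s)) ?size_polyD //.
rewrite (@opmod_scaleE N r) ?leq_maxl // (@opmod_scaleE N s) ?leq_maxr //.
by rewrite -big_split; apply: eq_bigr => i _; rewrite coefD scalerDl.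
Qed.

Lemma opmod_scaleDr : right_distributive opmod_scale +%R.
Proof.
move=> r A B; rewrite -big_split; apply: eq_bigr => i _.
by rewrite mulrDl scalerDr.
Qed.

Lemma opmod_scaleC a A : opmod_scale a%:P A = a *: (A : D).
Proof.
by rewrite (@opmod_scaleE 1) ?size_polyC ?leq_b1 // big_ord1 coefC expr0 mulr1.
Qed.

Lemma opmod_scaleMX r A : opmod_scale (r * 'X) A = opmod_scale r A * P.
Proof.
rewrite (@opmod_scaleE (size r).+1); last first.
  by rewrite (leq_trans (size_polyMleq _ _)) // size_polyX addn2.
rewrite big_ord_recl coefMX scale0r add0r mulr_suml; apply: eq_bigr => i _.
by rewrite coefMX -scalerAl -mulrA -exprSr.
Qed.

Lemma opmod_scale0l A : opmod_scale 0 A = 0.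
Proof. by rewrite /opmod_scale size_poly0 big_ord0. Qed.

Lemma opmod_scaleA r s A :
  opmod_scale r (opmod_scale s A) = opmod_scale (r * s) A.
Proof.
elim/poly_ind: r => [|r c IH]; first by rewrite mul0r !opmod_scale0l.
rewrite mulrDl !opmod_scaleDl mulrAC !opmod_scaleMX IH; congr (_ + _).
rewrite opmod_scaleC /opmod_scale (_ : c%:P * s = c *: s) ?mul_polyC //.
rewrite -/(opmod_scale (c *: s) A) (@opmod_scaleE (size s)) ?size_scale_leq //.
by rewrite scaler_sumr; apply: eq_bigr => i _; rewrite coefZ scalerA.
Qed.

Lemma opmod_scale1 : left_id 1 opmod_scale.
Proof. by move=> A; rewrite opmod_scaleC scale1r. Qed.

HB.instance Definition _ := GRing.Zmodule_isLmodule.Build {poly K} opmod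
  opmod_scaleA opmod_scale1 opmod_scaleDr opmod_scaleDl.

End OperatorModule.

Section OperatorBasis.
Variables (K : diffFieldType) (P : diffop K) (n' : nat).
Local Notation n := n'.+1.
Local Notation D := (diffop K).
Local Notation M := (opmod P).
Local Notation d := (dop_d K).
Hypothesis sizeP : size (P : {poly K}) = n.+1.

Lemma opmodCE a (A : M) : a%:P *: A = (a *: (A : D) : D).
Proof. exact: opmod_scaleC. Qed.

Lemma opmodXE (A : M) : 'X *: A = ((A : D) * P : D).
Proof. by rewrite -['X]mul1r [LHS]opmod_scaleMX opmod_scaleC scale1r. Qed.

(** Right multiplication by an operator commuting with P is
    K[lambda]-linear. *)
Lemma opmod_mulr r (A : M) (T : D) : P * T = T * P ->
  ((r *: A : D) * T : D) = r *: ((A : D) * T : M).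
Proof.
move=> PT; rewrite /GRing.scale /= /opmod_scale mulr_suml; apply: eq_bigr => k _.
rewrite -scalerAl -!mulrA; congr (_ *: (_ * _)).
by apply: esym; exact: (commrX k (esym PT)).
Qed.

(** Left multiplication by d is a connection: it satisfies the Leibniz
    rule over K[lambda], where lambda is a constant. *)
Lemma opmod_dmul r (A : M) :
  (d * (r *: A : D) : D) = der r *: A + r *: (d * (A : D) : M).
Proof.
have -> : der r *: A = _ := opmod_scaleE A (size_poly (size r) _).
have -> : r *: (d * (A : D) : M) = _ := opmod_scaleE _ (leqnn _).
have -> : r *: A = _ := opmod_scaleE A (leqnn _).
rewrite addrC mulr_sumr -big_split /=; apply: eq_bigr => k _.
by rewrite dop_dZ mulrA coef_map.
Qed.

Definition from_coord (v : 'rV[{poly K}]_n) : M :=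
  \sum_i v 0 i *: (d ^+ i : M).

Lemma from_coord_is_linear : linear from_coord.
Proof.
move=> r u v; rewrite scaler_sumr -big_split; apply: eq_bigr => i _.
by rewrite !mxE scalerDl scalerA.
Qed.

HB.instance Definition _ :=
  GRing.isLinear.Build {poly K} 'rV[{poly K}]_n M _ from_coord from_coord_is_linear.

Lemma from_coord_delta i : from_coord (delta_mx 0 i) = d ^+ i.
Proof.
rewrite /from_coord (bigD1 i) //= big1 ?addr0.
  by rewrite mxE !eqxx scale1r.
by move=> j ji; rewrite mxE (negPf ji) andbF scale0r.
Qed.

Lemma size_dX i : size (d ^+ i : {poly K}) = i.+1.
Proof. by rewrite dop_dXE size_polyXn. Qed.

Lemma dop_neq0 A : (0 < size (A : {poly K}))%N -> A != 0 :> D.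
Proof. by rewrite size_poly_gt0. Qed.

(** For each order s the image contains an operator of order s: d^s
    when s < n, and d^(s-n) * P, which is lambda times d^(s-n), otherwise. So
    leading terms can be eliminated. *)
Lemma from_coord_surj (A : M) : exists v, from_coord v == A.
Proof.
have [N] := ubnP (size (A : {poly K})); elim: N A => // N IH A szN.
have [->|A0] := eqVneq A 0; first by exists 0; rewrite raddf0.
have sA : (0 < size (A : {poly K}))%N by rewrite size_poly_gt0.
suff [T [szT [w eqT]]] : exists T : M,
    size (T : {poly K}) = size (A : {poly K}) /\ exists w, from_coord w = T.
  have [|v /eqP eqv] := IH (A - (lead_coef A / lead_coef T)%:P *: T).
    rewrite -ltnS; apply: leq_ltn_trans szN.
    by rewrite opmodCE; apply: size_cancel_lead; rewrite ?szT.
  exists (v + (lead_coef A / lead_coef T)%:P *: w).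
  by rewrite raddfD /= linearZ /= eqT eqv subrK.
have [lts|les] := ltnP (size (A : {poly K})).-1 n.
  exists (d ^+ (size (A : {poly K})).-1 : D); rewrite size_dX prednK //.
  by split=> //; exists (delta_mx 0 (Ordinal lts)); rewrite from_coord_delta.
pose s := ((size (A : {poly K})).-1 - n)%N.
have [|u /eqP equ] := IH (d ^+ s : D).
  rewrite size_dX -ltnS; apply: leq_ltn_trans szN.
  by rewrite -[X in (_ < X)%N](prednK sA) ltnS /s ltn_subrL (leq_trans _ les).
exists (d ^+ s * P : D); split; last first.
  by exists ('X *: u); rewrite linearZ /= equ opmodXE.
rewrite size_dopM ?dop_neq0 ?size_dX ?sizeP //.
by rewrite addnS /= addSn /s subnK // prednK.
Qed.

(** Write v = v0 + lambda w with v0 constant in lambda. The part of the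
    combination coming from v0 has order less than n, while the part coming
    from w is a right multiple of P, of order at least n unless it vanishes.
    Hence both parts vanish, and w has smaller degree in lambda. *)
Lemma from_coord_eq0 (v : 'rV[{poly K}]_n) : from_coord v = 0 -> v = 0.
Proof.
have: exists N, forall i, (size (v 0%R i) <= N)%N.
  exists (\max_i size (v 0%R i)) => i.
  exact: (leq_bigmax (F := fun i => size (v 0%R i))).
case=> N; elim: N v => [|N IH] v szv evv.
  apply/rowP=> i; rewrite mxE; apply/eqP.
  by rewrite -size_poly_leq0.
pose w : 'rV[{poly K}]_n := \row_i \poly_(k < N) (v 0 i)`_k.+1.
have eqv i : v 0 i = ((v 0 i)`_0)%:P + 'X * w 0 i.
  apply/polyP=> k; rewrite coefD coefC coefXM mxE.
  case: k => [|k]; rewrite /= ?addr0 // add0r coef_poly.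
  by case: ltnP => // leNk; rewrite nth_default // (leq_trans (szv i)).
pose A0 : {poly K} := \sum_i (v 0 i)`_0 *: 'X^i.
have sA0 : (size A0 <= n)%N.
  apply: leq_trans (size_sum _ _ _) _; apply/bigmax_leqP => i _.
  by apply: leq_trans (size_scale_leq _ _) _; rewrite size_polyXn.
have ev_split : from_coord v = A0 + (from_coord w : D) * P :> {poly K}.
  rewrite /A0 -opmodXE scaler_sumr -big_split; apply: eq_bigr => i _ /=.
  by rewrite {1}eqv scalerDl scalerA opmodCE dop_dXE.
have w0 : w = 0.
  apply: IH => [i|]; first by rewrite mxE size_poly.
  apply/eqP; apply: contraTT sA0 => ew0; rewrite -ltnNge.
  have -> : A0 = - ((from_coord w : D) * P).
    by apply/eqP; rewrite -addr_eq0 -ev_split evv.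
  rewrite size_polyN size_dopM // ?sizeP; last by rewrite dop_neq0 // sizeP.
  by rewrite addnS /= -[X in (X < _)%N]add0n ltn_add2r size_poly_gt0.
move: ev_split; rewrite evv w0 raddf0 mul0r addr0 => /polyP A00.
apply/rowP=> i; rewrite eqv w0 !mxE mulr0 addr0.
have := A00 i; rewrite coef0 /A0 coef_sum (bigD1 i) //= big1 => [|j ji].
  by rewrite coefZ coefXn eqxx mulr1 addr0 => <-.
by rewrite coefZ coefXn eq_sym (inj_eq val_inj) (negPf ji) mulr0.
Qed.

(** Coordinates enter only through this property, not through the way
    they are chosen. *)
Lemma exists_coord : {c : M -> 'rV[{poly K}]_n | cancel c from_coord}.
Proof.
exists (fun A => xchoose (from_coord_surj A)) => A.
exact/eqP/(xchooseP (from_coord_surj A)).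
Qed.

Definition dop_coord : M -> 'rV[{poly K}]_n := sval exists_coord.

Lemma coordK : cancel dop_coord from_coord.
Proof. exact: svalP exists_coord. Qed.

Lemma from_coordK : cancel from_coord dop_coord.
Proof.
move=> v; apply/eqP; rewrite -subr_eq0; apply/eqP/from_coord_eq0.
by rewrite raddfB /= coordK subrr.
Qed.

Lemma coord_is_linear : linear dop_coord.
Proof.
move=> r A B; apply: (can_inj from_coordK).
by rewrite linearP /= !coordK.
Qed.

HB.instance Definition _ :=
  GRing.isLinear.Build {poly K} M 'rV[{poly K}]_n _ dop_coord coord_is_linear.

Lemma dop_coordZ r (A : M) : dop_coord (r *: A) = r *: dop_coord A.
Proof. exact: linearZ. Qed.

Definition mulr_mx (T : D) : 'M[{poly K}]_n := \matrix_i dop_coord (d ^+ i * T : D).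
Definition connection_mx : 'M[{poly K}]_n := \matrix_i dop_coord (d * d ^+ i : D).

Lemma coord_dX (i : 'I_n) : dop_coord (d ^+ i : D) = delta_mx 0 i.
Proof. by rewrite -from_coord_delta from_coordK. Qed.

Lemma coord_mulr (T : D) (A : M) : P * T = T * P ->
  dop_coord ((A : D) * T : D) = dop_coord A *m mulr_mx T.
Proof.
move=> PT; rewrite -{1}[A]coordK mulmx_sum_row /from_coord mulr_suml raddf_sum.
apply: eq_bigr => i _ /=.
by rewrite opmod_mulr // linearZ /= rowK.
Qed.

Lemma coord_dmul (A : M) :
  dop_coord (d * (A : D) : D) = map_mx der (dop_coord A) + dop_coord A *m connection_mx.
Proof.
rewrite -{1}[A]coordK /from_coord mulr_sumr raddf_sum /= mulmx_sum_row.
rewrite [map_mx _ _]row_sum_delta -big_split; apply: eq_bigr => i _ /=.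
by rewrite opmod_dmul raddfD /= !linearZ /= coord_dX rowK mxE.
Qed.

(** Compute the coordinates of d * d^i * T in two ways: T multiplied on the
    right after d, or d on the left after T. *)
Lemma der_mulr_mx (T : D) : P * T = T * P ->
  map_mx der (mulr_mx T) = connection_mx *m mulr_mx T - mulr_mx T *m connection_mx.
Proof.
move=> PT; apply/eqP; rewrite eq_sym subr_eq; apply/eqP/row_matrixP => i.
rewrite raddfD /= !row_mul.
have := coord_dmul (d ^+ i * T : D); rewrite mulrA coord_mulr //.
by rewrite !rowK => ->; congr (_ + _); apply/rowP=> j; rewrite !mxE.
Qed.

(** The variable mu is a constant and scalar matrices are central, so the
    commutator formula for B passes to mu - B. *)
Lemma der_char_poly_mulr_mx (T : D) : P * T = T * P ->
  der (char_poly (mulr_mx T)) = 0.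
Proof.
move=> PT; apply: (@der_det_commutator _ _ _ (map_mx polyC connection_mx)).
have -> : map_mx der (char_poly_mx (mulr_mx T))
    = - map_mx polyC (map_mx der (mulr_mx T)).
  apply/matrixP=> i j; rewrite !mxE derD derN der_polyC.
  by rewrite raddfMn [X in X *+ _]der_polyX mul0rn add0r.
rewrite der_mulr_mx // /char_poly_mx map_mxB !map_mxM mulmxBr mulmxBl.
by rewrite scalar_mxC !opprB [RHS]addrC subrKA.
Qed.

(** Right multiplication by g(P, Q) has matrix g(lambda, B). The
    coefficients of g are constants, so they can be moved to the left of A. *)
Lemma coord_eval (Q : D) (g : {poly {poly constants K}}) (A : M) :
  P * Q = Q * P ->
  dop_coord ((A : D) * dop_eval P Q g : D)
  = dop_coord A *m horner_mx (mulr_mx Q) (const_inj g).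
Proof.
move=> PQ.
have PQj j : P * Q ^+ j = Q ^+ j * P by exact: (commrX j PQ).
have coordQ j : dop_coord ((A : D) * Q ^+ j : D) = dop_coord A *m mulr_mx Q ^+ j.
  elim: j => [|j IH]; first by rewrite !expr0 mulr1 mulmx1.
  by rewrite !exprSr mulrA coord_mulr // IH mulmxA.
have -> : (A : D) * dop_eval P Q g
   = \sum_(j < size g) ((map_poly (@const_val K) g`_j *: A : D) * Q ^+ j).
  rewrite /dop_eval mulr_sumr; apply: eq_bigr => j _.
  rewrite mulr_sumr {1}/GRing.scale /= (@opmod_scaleE _ P (size g`_j)) ?size_poly //.
  rewrite mulr_suml; apply: eq_bigr => i _.
  by rewrite coef_map /= !mulrA mul_dop_const ?der_const_val // -scalerAl.
rewrite raddf_sum /= /horner_mx /= /horner_morph horner_coef.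
rewrite (size_map_inj_poly) ?raddf0 //; last first.
  by move=> a b /matrixP/(_ 0 0); rewrite !mxE !mulr1n.
rewrite size_const_inj mulmx_sumr; apply: eq_bigr => j _.
have -> : (map_poly scalar_mx (const_inj g))`_j
   = (map_poly (@const_val K) g`_j)%:M :> 'M_n.
  by rewrite coef_map_id0 ?raddf0 // /const_inj coef_map.
by rewrite -mulmxE mul_scalar_mx -scalemxAr opmod_mulr // linearZ /= coordQ scalemxAl.
Qed.

(** Row i of g(lambda, B) holds the coordinates of d^i * g(P, Q), and
    row 0 those of g(P, Q) itself. *)
Lemma BC_horner_mx (Q : D) (g : {poly {poly constants K}}) : P * Q = Q * P ->
  (g \in BC P Q) = (horner_mx (mulr_mx Q) (const_inj g) == 0).
Proof.
move=> PQ; rewrite -topredE /= /BC; apply/eqP/eqP => [e0|h0].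
  apply/row_matrixP=> i; rewrite row0 rowE -coord_dX -coord_eval //.
  by rewrite e0 mulr0 raddf0.
apply: (can_inj coordK); rewrite -[dop_eval _ _ _]mul1r coord_eval //.
by rewrite h0 mulmx0 raddf0.
Qed.

(** Both sides have the coordinates of 1 times g1(lambda, B) g2(lambda, B),
    and distinct operators have distinct coordinates. *)
Lemma dop_evalM (Q : D) (g1 g2 : {poly {poly constants K}}) : P * Q = Q * P ->
  dop_eval P Q (g1 * g2) = dop_eval P Q g1 * dop_eval P Q g2.
Proof.
move=> PQ; apply: (can_inj coordK); rewrite coord_eval //.
rewrite -[dop_eval _ _ g1]mul1r -[dop_eval _ _ (_ * _)]mul1r !coord_eval //.
by rewrite !rmorphM /= mulmxA.
Qed.

End OperatorBasis.

(** * The characteristic polynomial and the Burchnall-Chaundy ideal *)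

(** As B is a root of g, the linear factor y - B splits off the scalar
    matrix g(y) by the factor theorem in the ring of polynomials with matrix
    coefficients; take determinants. *)
Lemma char_poly_dvd_exp (R : comNzRingType) n (B : 'M[R]_n.+1) (g : {poly R}) :
  horner_mx B g = 0 -> exists q, g ^+ n.+1 = q * char_poly B.
Proof.
have [phi [bij_phi phiZ phiC _]] := mx_poly_ring_isom R n.
case: bij_phi => psi phiK psiK gB0.
have /factor_theorem[q eqq] : root (map_poly scalar_mx g) B by apply/eqP.
exists (\det (psi q)); rewrite -det_scalar -det_mulmx; congr (\det _).
apply: (can_inj phiK); rewrite phiZ eqq rmorphM /= psiK; congr (_ * _).
by rewrite rmorphB phiC phiZ map_polyX.
Qed.

Section SpectralCurve.
Variables (K : diffFieldType) (P Q : diffop K) (n' : nat).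
Local Notation n := n'.+1.
Local Notation CXY := {poly {poly constants K}}.
Hypothesis charC : [pchar (constants K)] =i pred0.
Hypothesis sizeP : size (P : {poly K}) = n.+1.
Hypothesis PQ : P * Q = Q * P.
Local Notation B := (mulr_mx sizeP Q).

(** Evaluation at (P, Q) is multiplicative and K[d] is a domain. *)
Lemma BC_prime (g1 g2 : CXY) :
  g1 * g2 \in BC P Q -> g1 \in BC P Q \/ g2 \in BC P Q.
Proof.
rewrite -!topredE /= /BC (dop_evalM sizeP) // => /eqP /dop_mul_eq0.
by case=> ->; [left|right].
Qed.

(** Among the elements of BC(P, Q) monic in mu, of which chi is one, take p of
    least degree in mu, and a monic irreducible factor g1 of p over K. Both g1
    and the cofactor have constant coefficients. One of them is in BC(P, Q), and
    by minimality it is g1. *)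
Lemma exists_monic_irreducible_BC : exists f : CXY,
  [/\ const_inj f \is monic, irreducible_elt (const_inj f) & f \in BC P Q].
Proof.
have BCE (g : CXY) := BC_horner_mx sizeP g PQ.
have [|p [monp [g [eqg gBC]]] pmin] := @exists_min_size _
   (fun p => p \is monic /\ exists g : CXY, const_inj g = p /\ g \in BC P Q).
  have [g eqg] := der0_const_inj (der_char_poly_mulr_mx sizeP PQ).
  exists (char_poly B); split; first exact: char_poly_monic.
  by exists g; rewrite BCE eqg Cayley_Hamilton.
have szp : (1 < size p)%N.
  apply: monic_size_gt1 => //; apply: contraTneq gBC => p1.
  by rewrite BCE eqg p1 rmorph1 oner_eq0.
have [g1 [q [mon1 monq irr1 eqp]]] := exists_monic_irreducible_factor monp szp.
have dp : der p = 0 by rewrite -eqg der_const_inj.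
have dg1 : der g1 = 0.
  by apply: (der_monic_factor charC mon1 irr1 (monic_neq0 monq)); rewrite -eqp.
have dq : der q = 0.
  by apply: (der0_cofactor mon1 dg1); rewrite mulrC -eqp.
have [a eqa] := der0_const_inj dg1; have [b eqb] := der0_const_inj dq.
have eqab : g = a * b by apply: const_inj_inj; rewrite rmorphM /= eqa eqb eqg.
exists a; rewrite eqa; split=> //.
case: (@BC_prime a b); rewrite -?eqab // => bBC.
have [|] := leqP (size p) (size q) => [|ltqp]; last first.
  have := pmin q; rewrite leqNgt ltqp => /(_ _) H.
  by suff: false by []; apply: H; split=> //; exists b.
have szg1 : (1 < size g1)%N.
  apply: monic_size_gt1 => //; case: irr1 => _ nu1 _.
  by apply: contraNneq nu1 => ->; rewrite unitr1.
rewrite eqp size_monicM ?monic_neq0 //.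
by case: (size g1) szg1 => [|[|k]] // _; rewrite !addSn /= leqNgt ltnS leq_addl.
Qed.

(** The polynomial chi divides f^n and f is prime, so chi is a power of f,
    of positive exponent since chi has degree n in mu. If g is in BC(P, Q), then
    f divides g^n, hence g, over K, and the cofactor is annihilated by the
    derivation like f and g. *)
Lemma BC_char_poly : exists (f : CXY) k,
  [/\ const_inj f \is monic, irreducible_elt (const_inj f),
      char_poly B = const_inj f ^+ k.+1
    & forall g, g \in BC P Q <-> exists q, g = q * f].
Proof.
have [f [monf irrf fBC]] := exists_monic_irreducible_BC.
have BCE (g : CXY) := BC_horner_mx sizeP g PQ.
have primef := monic_irreducible_prime_elt monf irrf.
have monX := char_poly_monic B.
have [k eqX] : exists k, char_poly B = const_inj f ^+ k.+1.
  have [q eqq] : exists q, const_inj f ^+ n = q * char_poly B.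
    by apply: char_poly_dvd_exp; apply/eqP; rewrite -BCE.
  have [|j] := @factor_prime_power _ _ irrf primef 1 n (char_poly B) q (unitr1 _).
    by rewrite mul1r eqq mulrC.
  move/(monic_associated monX (monic_exp _ monf)) => eqX.
  case: j eqX => [|j] eqX; last by exists j.
  by have := size_char_poly B; rewrite eqX expr0 size_poly1.
exists f, k; split=> // g; split=> [|[q ->]]; last first.
  by rewrite BCE !rmorphM /= (eqP (_ : horner_mx B (const_inj f) == 0)) ?mulr0 -?BCE.
rewrite BCE => /eqP /char_poly_dvd_exp [q].
rewrite eqX [const_inj f ^+ _]exprSr mulrA => eqg.
have {q eqg} [q eqg] : exists q, const_inj g = q * const_inj f.
  have : exists q, const_inj g ^+ n = q * const_inj f by eexists; apply: eqg.
  elim: n => [|l IH] dv.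
    have [r] := dv; rewrite expr0 => r1; case: irrf => _ /negP[].
    by apply/unitrPr; exists r; rewrite mulrC r1.
  by move: dv; rewrite exprS => /primef [].
have dq : der q = 0.
  by apply: (der0_cofactor monf (der_const_inj f)); rewrite -eqg der_const_inj.
have [a eqa] := der0_const_inj dq.
by exists a; apply: const_inj_inj; rewrite rmorphM /= eqa.
Qed.

End SpectralCurve.

(** * The differential resultant as a characteristic polynomial *)

Lemma det_conj_perm (R : comNzRingType) n (s : 'S_n) (A : 'M[R]_n) :
  \det (\matrix_(i, j) A (s i) (s j)) = \det A.
Proof.
have -> : \matrix_(i, j) A (s i) (s j) = row_perm s (col_perm s A).
  by apply/matrixP=> i j; rewrite !mxE.
rewrite row_permE col_permE !det_mulmx !det_perm odd_permV mulrCA -signr_addb.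
by rewrite addbb mulr1.
Qed.

(** Column operations: the matrix with block columns (1, 0) and W is
    unipotent, and it makes the block matrix block triangular. *)
Lemma det_col_mx_reduce (R : comNzRingType) m n (T1 : 'M[R]_(m, m + n))
    (T2 : 'M[R]_(n, m + n)) (W : 'M[R]_(m + n, n)) :
  dsubmx W = 1%:M -> T1 *m W = 0 ->
  \det (col_mx T1 T2) = \det (lsubmx T1) * \det (T2 *m W).
Proof.
move=> W1 T1W; pose V : 'M[R]_(m + n) := row_mx (col_mx 1%:M 0) W.
have detV : \det V = 1.
  by rewrite /V -[W]vsubmxK W1 -block_mxEh det_ublock !det1 mulr1.
have mulV p (T : 'M[R]_(p, m + n)) : T *m col_mx 1%:M 0 = lsubmx T.
  by rewrite -{1}[T]hsubmxK mul_row_col mulmx1 mulmx0 addr0.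
rewrite -[LHS]mulr1 -detV -det_mulmx /V mul_mx_row !mul_col_mx T1W !mulV.
by rewrite -block_mxEh det_lblock.
Qed.

Section Lift.
Variable K : diffFieldType.
Local Notation S := {poly {poly K}}.
Local Notation D := (diffop K).

Lemma coef_dop_lift (T : D) k : (dop_lift T)`_k = (T`_k)%:P%:P.
Proof. by rewrite coef_map_id0. Qed.

Lemma size_dop_lift (T : D) : size (dop_lift T : {poly S}) = size (T : {poly K}).
Proof. by apply: size_map_inj_poly => // a b /polyC_inj/polyC_inj. Qed.

Lemma dop_lift_dM (T : D) : dop_lift (dop_d K * T) = dop_d S * dop_lift T.
Proof.
rewrite !dop_dM /diffop_dmul; apply/polyP=> k.
rewrite coef_dop_lift !coefD !coefMX !coef_poly_der !coef_dop_lift !der_polyC.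
by case: eqP => _; rewrite ?add0r // !polyCD.
Qed.

Lemma dop_lift_dXM i (T : D) :
  dop_lift (dop_d K ^+ i * T) = dop_d S ^+ i * dop_lift T.
Proof.
elim: i => [|i IH]; first by rewrite !expr0 !mul1r.
by rewrite !exprS -!mulrA dop_lift_dM IH.
Qed.

Lemma dop_lift_dX i : dop_lift (dop_d K ^+ i) = dop_d S ^+ i.
Proof. by apply/polyP=> k; rewrite coef_dop_lift !dop_dXE !coefXn -!polyC_natr. Qed.

(** lambda and mu are constants, hence central in K[lambda, mu][d]. *)
Lemma dX_lift_sub i (T : D) (c : S) : der c = 0 ->
  dop_d S ^+ i * (dop_lift T - dop_const c)
  = dop_lift (dop_d K ^+ i * T) - c *: dop_lift (dop_d K ^+ i).
Proof.
by move=> dc; rewrite mulrBr mul_dop_const // dop_lift_dXM dop_lift_dX.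
Qed.

Lemma der_lambda : der (lambda K) = 0.
Proof. by rewrite der_polyC der_polyX. Qed.

Lemma der_mu : der (mu K) = 0.
Proof. exact: der_polyX. Qed.

Lemma dop_order_lift_sub (T : D) (c : S) : (0 < dop_order T)%N ->
  dop_order (dop_lift T - dop_const c) = dop_order T.
Proof.
rewrite /dop_order => szT; rewrite size_polyDl ?size_dop_lift //.
rewrite size_polyN size_polyC (leq_ltn_trans (leq_b1 _)) //.
by case: (size _) szT.
Qed.

End Lift.

Section Reduction.
Variables (K : diffFieldType) (P Q : diffop K) (m n' : nat).
Local Notation n := n'.+1.
Local Notation S := {poly {poly K}}.
Local Notation d := (dop_d K).
Hypothesis sizeP : size (P : {poly K}) = n.+1.
Hypothesis sizeQ : size (Q : {poly K}) = m.+1.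
Local Notation crd := (dop_coord sizeP).

(** Reduction modulo the left ideal generated by P - lambda, on operators over
    K[lambda, mu] of order less than m + n: each d^k is replaced by its
    coordinates in D. *)
Definition reduce (A : diffop S) : 'rV[S]_n :=
  \sum_(k < m + n) A`_k *: map_mx polyC (crd (d ^+ k)).

Lemma reduceB : {morph reduce : A B / A - B}.
Proof.
move=> A B; rewrite /reduce -sumrB; apply: eq_bigr => k _.
by rewrite coefB scalerBl.
Qed.

Lemma reduceZ c A : reduce (c *: A) = c *: reduce A.
Proof.
rewrite /reduce scaler_sumr; apply: eq_bigr => k _.
by rewrite coefZ scalerA.
Qed.

Lemma reduce_lift (T : diffop K) : (size (T : {poly K}) <= m + n)%N ->
  reduce (dop_lift T) = map_mx polyC (crd T).
Proof.
move=> szT.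
have eqT : T = \sum_(k < m + n) T`_k *: d ^+ k.
  rewrite {1}[T]dop_expansion (big_ord_widen _ (fun k => T`_k *: d ^+ k) szT).
  rewrite big_mkcond; apply: eq_bigr => i _.
  by case: ltnP => // /(nth_default 0) ->; rewrite scale0r.
rewrite {2}eqT raddf_sum /= map_mx_sum; apply: eq_bigr => k _.
rewrite coef_dop_lift -[X in _ = map_mx _ X]/(crd (T`_k *: d ^+ k : diffop K)).
have -> : T`_k *: d ^+ k = (T`_k)%:P *: (d ^+ k : opmod P) by rewrite opmodCE.
by rewrite dop_coordZ map_mxZ.
Qed.

Definition row_block (A : diffop S) p : 'M[S]_(p, m + n) :=
  \matrix_(i < p, k < m + n) dop_coef (dop_d S ^+ rev_ord i * A) (rev_ord k).

Definition reduce_mx : 'M[S]_(m + n, n) :=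
  \matrix_(k < m + n, j < n) (crd (d ^+ rev_ord k) 0 (rev_ord j))%:P.

Lemma row_block_reduce A p i j :
  (row_block A p *m reduce_mx) i j
  = reduce (dop_d S ^+ rev_ord i * A) 0 (rev_ord j).
Proof.
rewrite mxE /reduce summxE (reindex_inj rev_ord_inj); apply: eq_bigr => k _.
by rewrite !mxE rev_ordK.
Qed.

Lemma size_dXM i (T : diffop K) : T != 0 ->
  size (d ^+ i * T : {poly K}) = (size (T : {poly K}) + i)%N.
Proof.
move=> T0; rewrite size_dopM // ?size_dX; first by rewrite addSn addnC.
by rewrite -size_poly_gt0 size_dX.
Qed.

Lemma P_neq0 : P != 0. Proof. by rewrite -size_poly_gt0 sizeP. Qed.
Lemma Q_neq0 : Q != 0. Proof. by rewrite -size_poly_gt0 sizeQ. Qed.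

(** d^i * P is lambda times d^i in the module, so d^i * (P - lambda)
    reduces to 0. *)
Lemma reduce_P_rows :
  row_block (dop_lift P - dop_const (lambda K)) m *m reduce_mx = 0.
Proof.
apply/matrixP=> i j; rewrite row_block_reduce dX_lift_sub ?der_lambda //.
have lti := ltn_ord (rev_ord i).
rewrite reduceB reduceZ !reduce_lift ?size_dXM ?P_neq0 ?size_dX ?sizeP //.
- by rewrite -opmodXE dop_coordZ map_mxZ subrr mxE [RHS]mxE.
- by rewrite (leq_trans lti) // leq_addr.
- by rewrite addSnnS addnC leq_add2r.
Qed.

(** For j < n the operator d^j * (Q - mu) reduces to row j of B - mu. The
    indices are reversed because the columns of the resultant go from the
    highest power of d to the lowest. *)
Lemma reduce_Q_rows :
  row_block (dop_lift Q - dop_const (mu K)) n *m reduce_mx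
  = \matrix_(i, j) (- char_poly_mx (mulr_mx sizeP Q)) (rev_ord i) (rev_ord j).
Proof.
apply/matrixP=> i j; rewrite row_block_reduce dX_lift_sub ?der_mu //.
have lti := ltn_ord (rev_ord i).
rewrite reduceB reduceZ !reduce_lift ?size_dXM ?Q_neq0 ?size_dX ?sizeQ //.
- rewrite coord_dX !mxE eqxx /= opprB; congr (_ - _).
  by rewrite eq_sym; case: eqP => _; rewrite ?mulr1 ?mulr0 ?mulr1n.
- by rewrite (leq_trans lti) // leq_addl.
- by rewrite addSnnS leq_add2l.
Qed.

Lemma dsubmx_reduce_mx : dsubmx reduce_mx = 1%:M.
Proof.
apply/matrixP=> i j; rewrite !mxE.
have -> : nat_of_ord (rev_ord (rshift m i)) = rev_ord i.
  by rewrite /= -addnS subnDl.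
rewrite coord_dX mxE eqxx /= eq_sym (inj_eq rev_ord_inj).
by case: (i == j).
Qed.

Lemma det_reduce :
  \det (col_mx (row_block (dop_lift P - dop_const (lambda K)) m)
               (row_block (dop_lift Q - dop_const (mu K)) n))
  = \det (lsubmx (row_block (dop_lift P - dop_const (lambda K)) m))
    * \det (- char_poly_mx (mulr_mx sizeP Q)).
Proof.
rewrite (det_col_mx_reduce _ dsubmx_reduce_mx reduce_P_rows) reduce_Q_rows.
congr (_ * _); rewrite -[RHS](det_conj_perm (perm rev_ord_inj)).
by congr (\det _); apply/matrixP=> i j; rewrite mxE [RHS]mxE !permE.
Qed.

(** The coefficients of d^(m-1) * P, ..., P at the m highest powers of d form
    a triangular matrix with the nonzero leading coefficients on the diagonal.
    Subtracting lambda * d^r from d^r * P changes only coefficients above the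
    diagonal, because P has positive order. *)
Lemma det_lead_unit :
  \det (lsubmx (row_block (dop_lift P - dop_const (lambda K)) m))
    \is a GRing.unit.
Proof.
set L := lsubmx _.
have Lij (i j : 'I_m) : (j <= i)%N ->
    L i j = ((d ^+ rev_ord i * P)`_(rev_ord (lshift n j)))%:P%:P.
  move=> leji; rewrite mxE mxE /dop_coef dX_lift_sub ?der_lambda //.
  rewrite coefB coefZ !coef_dop_lift dop_dXE coefXn gtn_eqF ?mulr0 ?subr0 //=.
  by rewrite -addnBAC // -addn1 leq_add // leq_sub2l.
rewrite -det_tr det_trig.
  rewrite unitr_prod // => i _; rewrite mxE Lij //.
  have -> : rev_ord (lshift n i) = (size (d ^+ rev_ord i * P : {poly K})).-1 :> nat.
    by rewrite size_dXM ?P_neq0 // sizeP /= -addnBAC // addnC.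
  have c0 : lead_coef (d ^+ rev_ord i * P : {poly K}) != 0.
    by rewrite lead_coef_eq0 -size_poly_eq0 size_dXM ?P_neq0 // sizeP.
  by rewrite -lead_coefE !poly_unitE !coefC /= !size_polyC polyC_eq0 unitfE c0.
apply/is_trig_mxP => i j ltij; rewrite mxE Lij ?(ltnW ltij) //.
rewrite nth_default ?polyC0 // size_dXM ?P_neq0 // sizeP /=.
rewrite -addnBAC // [X in (_ <= X)%N]addnC addSn -addnS leq_add2l.
by rewrite -subSn // subSS leq_sub2l.
Qed.

Lemma dres_lift_sub : exists2 u : S, u \is a GRing.unit &
  \det (col_mx (row_block (dop_lift P - dop_const (lambda K)) m)
               (row_block (dop_lift Q - dop_const (mu K)) n))
  = u * char_poly (mulr_mx sizeP Q).
Proof.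
exists (\det (lsubmx (row_block (dop_lift P - dop_const (lambda K)) m)) * (-1) ^+ n).
  by rewrite unitrM det_lead_unit unitrX ?unitrN1.
by rewrite det_reduce -mulrA -[- char_poly_mx _]scaleN1r detZ.
Qed.

End Reduction.

(** * The theorem *)

Theorem theorem4p5 (K : diffFieldType)
    (closedC : GRing.closed_field_axiom (constants K))
    (charC : [pchar (constants K)] =i pred0)
    (P Q : diffop K)
    (ncP : ~~ const_coef P) (ncQ : ~~ const_coef Q)
    (commPQ : P * Q = Q * P)
    (ordP : (0 < dop_order P)%N) (ordQ : (0 < dop_order Q)%N) :
  let h := dres (dop_lift P - dop_const (lambda K))
                (dop_lift Q - dop_const (mu K)) in
  (exists f : {poly {poly constants K}}, squarefree_part (const_inj f) h) /\
  (forall f : {poly {poly constants K}}, squarefree_part (const_inj f) h ->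
     irreducible_elt f /\
     forall g : {poly {poly constants K}},
       g \in BC P Q <-> exists q, g = q * f).
Proof.
move=> h.
have [n sizeP] : exists n, size (P : {poly K}) = n.+2.
  by move: ordP; rewrite /dop_order; case: (size _) => [|[|n]] // _; exists n.
have [m sizeQ] : exists m, size (Q : {poly K}) = m.+1.
  by move: ordQ; rewrite /dop_order; case: (size _) => // m _; exists m.
have [f [k [monf irrf eqX BCf]]] := BC_char_poly charC sizeP commPQ.
have {eqX} assoc_h : associated h (const_inj f ^+ k.+1).
  have [u uu eqh] := dres_lift_sub sizeP sizeQ.
  exists u => //; rewrite -eqX -eqh.
  rewrite /h /dres /dres_mx /= !dop_order_lift_sub //.
  by rewrite /dop_order sizeP sizeQ.
have primef := monic_irreducible_prime_elt monf irrf.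
have irrf0 := irreducible_const_inj irrf.
have [sqf uniqf] := squarefree_part_prime_power irrf primef assoc_h.
split=> [|f1 /uniqf [u uu eqf1]]; first by exists f.
have du : der u = 0.
  by apply: (der0_cofactor monf (der_const_inj f)); rewrite -eqf1 der_const_inj.
have [v eqv] := der0_const_inj du.
have uv : v \is a GRing.unit by apply: unit_const_inj; rewrite eqv.
have eqvf : f1 = v * f by apply: const_inj_inj; rewrite rmorphM /= eqv.
split; first by apply: (irreducible_associated _ irrf0); exists v.
move=> g; rewrite BCf eqvf; split=> [[q ->]|[q ->]].
  by exists (q / v); rewrite mulrA divrK.
by exists (q * v); rewrite mulrA.
Qed.
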